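(* The ROM snapshots $\boldsymbol{u}^{ROM}_j=\boldsymbol{R}\,\boldsymbol{g}_j$ can be written as Chebyshev polynomials of the ROM propagator $\boldsymbol{\mathcal P}^{ROM}=\boldsymbol{R}^{-T}\boldsymbol{S}\boldsymbol{R}^{-1}$ applied to $\boldsymbol{b}^{ROM}=\boldsymbol{R}\,\boldsymbol{e}_0$: $$\boldsymbol{u}^{ROM}_j=\mathcal T_j\big(\boldsymbol{\mathcal P}^{ROM}\big)\,\boldsymbol{b}^{ROM},\qquad j\ge 0,$$ and the ROM $(\boldsymbol{\mathcal P}^{ROM},\boldsymbol{b}^{ROM})$ fits the data exactly: $$\boldsymbol{D}_j=\langle \boldsymbol{b},\mathcal T_j(\mathcal P)\boldsymbol{b}\rangle=(\boldsymbol{b}^{ROM})^T\,\mathcal T_j\big(\boldsymbol{\mathcal P}^{ROM}\big)\,\boldsymbol{b}^{ROM},\qquad j=0,\ldots,2n-1.$$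
   Context: Setting. $H$ is the real Hilbert space $L^2(\Omega)$ of (possibly vector valued) wave fields on a domain $\Omega\subset\mathbb R^d$. $L(q)$ is a first order partial differential operator (with homogeneous boundary conditions built into its domain) with adjoint $L(q)^T$. The results do not depend on the specific form of $L(q)$; what matters is that $L(q)L(q)^T$ is a self-adjoint nonnegative-definite operator on $H$. Let $\tau>0$ and let $m\ge1$, $n\ge2$ be integers. Wave propagator: $\mathcal P=\cos\big(\tau\sqrt{L(q)L(q)^T}\big)$, defined by functional calculus (a bounded self-adjoint operator on $H$ with spectrum in $[-1,1]$). $\mathcal T_j$ is the Chebyshev polynomial of the first kind of degree $j$. Block conventions. An $m$-tuple $\boldsymbol{w}=(w^{(1)},\ldots,w^{(m)})$ of elements of $H$ is regarded as a row; operators act on it entrywise, and matrices multiply it on the right. For two $m$-tuples, $\langle\boldsymbol{v},\boldsymbol{w}\rangle$ is the $m\times m$ matrix with entries $\langle v^{(r)},w^{(s)}\rangle_H$. Matrices of size $nm\times nm$ are partitioned into $m\times m$ blocks, with block indices $0,\ldots,n-1$. $\boldsymbol{e}_j\in\mathbb R^{nm\times m}$ has the identity $\boldsymbol{I}_m$ in block position $j$ and zeros elsewhere. Snapshots. $\boldsymbol{b}=(b^{(1)},\ldots,b^{(m)})$ is a given $m$-tuple in $H$ (initial wave), and $\boldsymbol{u}_j=\cos\big(j\tau\sqrt{L(q)L(q)^T}\big)\boldsymbol{b}=\mathcal T_j(\mathcal P)\boldsymbol{b}$. Standing assumption: the snapshots are linearly independent up to time $n\tau$, i.e. all the components of $\boldsymbol{u}_0,\ldots,\boldsymbol{u}_n$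 are linearly independent in $H$. Data: $\boldsymbol{D}_j=\langle\boldsymbol{b},\boldsymbol{u}_j\rangle\in\mathbb R^{m\times m}$, $j=0,\ldots,2n-1$. ROM. The mass and stiffness matrices $\boldsymbol{M},\boldsymbol{S}\in\mathbb R^{nm\times nm}$ have blocks $\boldsymbol{M}_{i,j}=\langle\boldsymbol{u}_i,\boldsymbol{u}_j\rangle$, $\boldsymbol{S}_{i,j}=\langle\boldsymbol{u}_i,\mathcal P\boldsymbol{u}_j\rangle$, $i,j=0,\ldots,n-1$. $\boldsymbol{M}$ is symmetric positive definite, and $\boldsymbol{M}=\boldsymbol{R}^T\boldsymbol{R}$ is a block Cholesky factorization, with $\boldsymbol{R}$ block upper triangular (invertible). $\boldsymbol{R}^{-T}$ denotes the transpose of $\boldsymbol{R}^{-1}$. The Galerkin coefficients $\boldsymbol{g}_j\in\mathbb R^{nm\times m}$ are defined by $\boldsymbol{g}_0=\boldsymbol{e}_0$, $\boldsymbol{g}_1=\boldsymbol{g}_{-1}=\boldsymbol{e}_1$ and $$\boldsymbol{M}\boldsymbol{g}_{j+1}=2\boldsymbol{S}\boldsymbol{g}_j-\boldsymbol{M}\boldsymbol{g}_{j-1},\qquad j\ge0$$ (the relation at $j=0$ is consistent with the prescribed values). *)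

(* Defs.v *)
From HB Require Import structures.
From mathcomp Require Import all_boot all_order all_algebra.
From mathcomp Require Import all_classical all_reals all_analysis.

Set Implicit Arguments.
Unset Strict Implicit.
Unset Printing Implicit Defensive.

Import Order.TTheory GRing.Theory Num.Theory.
Import numFieldNormedType.Exports.

Local Open Scope classical_set_scope.
Local Open Scope ring_scope.

(** * Real Hilbert spaces and unbounded operators *)

Record hilbert (R : realType) := Hilbert {
  hilbert_sort :> completeNormedModType R ;
  inner : {dot hilbert_sort for idfun} ;
  inner_norm : forall v, inner v v = `|v| ^+ 2 }.

Arguments inner {R h}.

(* The values of [op_fun] outside [op_dom] are irrelevant. *)
Record unbounded_op (R : realType) (H K : hilbert R) := UnboundedOp {
  op_dom : set H ;
  op_fun :> H -> K }.

Section operators.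
Variable R : realType.
Implicit Types H K G : hilbert R.

Definition linear_op H K (T : unbounded_op H K) :=
  op_dom T 0 /\
  forall (a : R) u v, op_dom T u -> op_dom T v ->
    op_dom T (a *: u + v) /\ T (a *: u + v) = a *: T u + T v.

Definition op_comp H K G (S : unbounded_op K G) (T : unbounded_op H K) :
    unbounded_op H G :=
  UnboundedOp [set v | op_dom T v /\ op_dom S (T v)] (fun v => S (T v)).

(* The equivalence also fixes the domain of the adjoint. *)
Definition is_adjoint H K (T : unbounded_op H K) (T' : unbounded_op K H) :=
  dense (op_dom T) /\
  forall v w, (op_dom T' v /\ T' v = w) <->
              (forall u, op_dom T u -> inner (T u) v = inner u w).

Definition self_adjoint H (A : unbounded_op H H) :=
  linear_op A /\ is_adjoint A A.

Definition nonneg_op H (A : unbounded_op H H) :=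
  forall v, op_dom A v -> 0 <= inner v (A v).

End operators.

(** * Spectral measures and the Borel functional calculus *)

Record spectral_measure (R : realType) (H : hilbert R) := SpectralMeasure {
  spm :> set (measurableTypeR R) -> H -> H ;
  spm_linear : forall B, measurable B -> linear (spm B) ;
  spm_sym : forall B u v, measurable B ->
    inner (spm B u) v = inner u (spm B v) ;
  spm0 : forall v, spm set0 v = 0 ;
  spmT : forall v, spm setT v = v ;
  spmI : forall B C v, measurable B -> measurable C ->
    spm (B `&` C) v = spm B (spm C v) ;
  spm_sigma_additive : forall u v,
    semi_sigma_additive (fun B => (inner u (spm B v))%:E) }.

Section spectral_calculus.
Variables (R : realType) (H : hilbert R) (E : spectral_measure H).

(* On Borel sets this is the scalar measure B |-> <v, E(B) v>, as E(B) is an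
   orthogonal projection; the squared norm is nonnegative on every set, which
   the interface of measures asks for. *)
Definition scalar_measure (v : H) (B : set (measurableTypeR R)) : \bar R :=
  (`|E B v| ^+ 2)%:E.

Lemma scalar_measureE v B : measurable B ->
  scalar_measure v B = (inner v (E B v))%:E.
Proof.
by move=> mB; rewrite /scalar_measure -inner_norm spm_sym// -spmI// setIid.
Qed.

Let scalar_measure0 v : scalar_measure v set0 = 0%E.
Proof. by rewrite /scalar_measure spm0 normr0 expr0n. Qed.

Let scalar_measure_ge0 v B : (0 <= scalar_measure v B)%E.
Proof. by rewrite lee_fin exprn_ge0. Qed.

Let scalar_measure_sigma_additive v : semi_sigma_additive (scalar_measure v).
Proof.
move=> F mF tF mUF; rewrite scalar_measureE//.
under eq_fun do under eq_bigr do rewrite scalar_measureE//.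
exact: (@spm_sigma_additive _ _ E v v).
Qed.

HB.instance Definition _ v := isMeasure.Build _ _ _ (scalar_measure v)
  (scalar_measure0 v) (scalar_measure_ge0 v) (@scalar_measure_sigma_additive v).

Definition spectral_dom (f : R -> R) : set H :=
  [set v | (\int[scalar_measure v]_x ((f x) ^+ 2)%:E < +oo)%E].

(* The integral of f against the signed measure B |-> <u, E(B) v>, obtained from
   the scalar measures by polarization. *)
Definition spectral_form (f : R -> R) (u v : H) : R :=
  (\int[scalar_measure (u + v)]_x f x - \int[scalar_measure (u - v)]_x f x) / 4.

(* w = (∫ f dE) v, where ∫ f dE has domain [spectral_dom f]; w is unique
   because that domain is dense. *)
Definition spectral_integral (f : R -> R) (v w : H) :=
  spectral_dom f v /\
  forall u, spectral_dom f u -> inner u w = spectral_form f u v.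

Definition spectral_measure_of (A : unbounded_op H H) :=
  forall v w, (op_dom A v /\ A v = w) <-> spectral_integral id v w.

(* f(A) v when E is the spectral measure of A. *)
Definition fun_calc (f : R -> R) (v : H) : H := xget 0 (spectral_integral f v).

(* cos (t sqrt A), for A nonnegative with spectral measure E. *)
Definition cos_sqrt (t : R) : H -> H :=
  fun_calc (fun x => cos (t * Num.sqrt x)).

End spectral_calculus.

(** * Chebyshev polynomials and their values at operators and matrices *)

Fixpoint chebyshevT (R : nzRingType) (j : nat) : {poly R} :=
  match j with
  | 0 => 1
  | 1 => 'X
  | (k.+1 as k').+1 => 2 *: 'X * chebyshevT R k' - chebyshevT R k
  end.

Definition poly_op (R : realType) (H : hilbert R) (p : {poly R})
    (T : H -> H) (v : H) : H :=
  \sum_(k < size p) p`_k *: iter k T v.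

(* [horner_mx] needs a dimension of the form N.+1. *)
Definition poly_mx (R : nzRingType) (N : nat) (p : {poly R}) (A : 'M[R]_N) :
    'M[R]_N :=
  \sum_(k < size p) p`_k *: A ^+ k.

(** * Block conventions *)

Notation block_dim n m := (\sum_(i < n) m)%N (only parsing).

Section blocks.
Variables (R : realType) (H : hilbert R) (m n : nat).

Definition gram (v w : 'I_m -> H) : 'M[R]_m :=
  \matrix_(r, s) inner (v r) (w s).

Definition block_e (k : nat) : 'M[R]_(block_dim n m, m) :=
  \mxcol_(i < n) (if i == k :> nat then 1%:M else 0 : 'M[R]_m).

Definition block_upper (U : 'M[R]_(block_dim n m)) :=
  forall i j : 'I_n, (j < i)%N -> submxblock U i j = 0.

Definition block_cholesky (M U : 'M[R]_(block_dim n m)) :=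
  block_upper U /\ M = U^T *m U.

Definition lin_indep_upto (u : nat -> 'I_m -> H) (N : nat) :=
  forall c : 'I_N.+1 -> 'I_m -> R,
    \sum_j \sum_r c j r *: u j r = 0 -> forall j r, c j r = 0.

Definition mass_mx (u : nat -> 'I_m -> H) : 'M[R]_(block_dim n m) :=
  \mxblock_(i < n, j < n) gram (u i) (u j).

Definition stiffness_mx (P : H -> H) (u : nat -> 'I_m -> H) :
    'M[R]_(block_dim n m) :=
  \mxblock_(i < n, j < n) gram (u i) (P \o u j).

Definition galerkin_coefs (M S : 'M[R]_(block_dim n m))
    (g : int -> 'M[R]_(block_dim n m, m)) :=
  [/\ g 0 = block_e 0, g 1 = block_e 1, g (- 1) = block_e 1 &
      forall j : int, 0 <= j ->
        M *m g (j + 1) = 2 *: (S *m g j) - M *m g (j - 1)].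

End blocks.

Arguments block_e {R m n} k.
Arguments mass_mx {R H m} n u.
Arguments stiffness_mx {R H m} n P u.

(* Main.v *)
Require Import Defs.
From mathcomp Require Import all_boot all_order all_algebra.
From mathcomp Require Import all_classical all_reals all_analysis.
From mathcomp Require Import measurable_realfun zify ring lra.

Set Implicit Arguments.
Unset Strict Implicit.
Unset Printing Implicit Defensive.

Import Order.TTheory GRing.Theory Num.Theory.
Import numFieldNormedType.Exports.

Local Open Scope classical_set_scope.
Local Open Scope ring_scope.

(** Everything rests on one identity of functional calculus,
      [2 cos(s sqrt A) cos(t sqrt A) = cos((s + t) sqrt A) + cos((s - t) sqrt A)]
    ([cos_sqrt_product]), together with the symmetry of these operators. It
    yields the three-term recurrence [u_(k+2) + u_k = 2 P u_(k+1)], hence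
    [u_j = T_j(P) b] ([poly_op_cos_sqrt]).

    The functional calculus is given by a formula for the form [<u, f(A) v>],
    from which neither the existence of the vector [f(A) v] nor the
    multiplicativity of [f |-> f(A)] can be read off. For step functions both
    are algebra in the spectral projections, and the norm of the operator is
    at most the supremum of the step function. A bounded Borel function is a
    uniform limit of step functions, so completeness of the space gives the
    operator, and its properties pass to the limit ([bounded_integral_exists],
    [bounded_integral_formM]).

    On the side of the reduced order model, multiplying the Galerkin recurrence
    by the inverse transpose of the Cholesky factor gives the same three-term
    recurrence for the ROM snapshots and the matrix PROM ([rom_step]), whence
    the Chebyshev formula ([rom_chebyshev]).

    The data fit compares Gram matrices. The columns of [M g_j] and the vectors
    of inner products [<u_i, u_j>] satisfy the same recurrence for j up to n
    ([galerkin_snapshots]): a Galerkin projection reproduces what lies in its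
    space, and [g_j = e_j] for j < n. It follows that
    [<uROM_k, uROM_l> = <u_k, u_l>] for k <= n and l < n. In both worlds the
    recurrence and the symmetry of the propagator turn such an inner product
    into data, through [2 T_k T_l = T_(k+l) + T_(k-l)] ([chebyshev_product]).
    Splitting j as k + l with k - l equal to 0 or 1 reaches every j up to
    2n - 1. *)

(** * Inner product *)

Section inner_product.
Context {R : realType} {H : hilbert R}.
Implicit Types u v w : H.

Lemma innerC u v : inner u v = inner v u.
Proof. by rewrite hermC expr0 mul1r. Qed.

Lemma innerDl u v w : inner (u + v) w = inner u w + inner v w.
Proof. exact: linearDl. Qed.

Lemma innerDr u v w : inner u (v + w) = inner u v + inner u w.
Proof. exact: linearDr. Qed.

Lemma innerBl u v w : inner (u - v) w = inner u w - inner v w.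
Proof. exact: linearBl. Qed.

Lemma innerBr u v w : inner u (v - w) = inner u v - inner u w.
Proof. exact: linearBr. Qed.

Lemma innerZl a u v : inner (a *: u) v = a * inner u v.
Proof. exact: linearZl_LR. Qed.

Lemma innerZr a u v : inner u (a *: v) = a * inner u v.
Proof. by rewrite innerC innerZl innerC. Qed.

Lemma inner_sumr (I : finType) u (F : I -> H) :
  inner u (\sum_i F i) = \sum_i inner u (F i).
Proof. exact: linear_sumr. Qed.

Lemma inner_suml (I : finType) u (F : I -> H) :
  inner (\sum_i F i) u = \sum_i inner (F i) u.
Proof.
by rewrite innerC inner_sumr; apply: eq_bigr => i _; rewrite innerC.
Qed.

Lemma inner_extr w w' : (forall u, inner u w = inner u w') -> w = w'.
Proof.
move=> ww'; apply/eqP; rewrite -subr_eq0 -normr_eq0 -sqrf_eq0 -inner_norm.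
by rewrite innerBr ww' subrr.
Qed.

Lemma polarization u v :
  inner u v = (inner (u + v) (u + v) - inner (u - v) (u - v)) / 4.
Proof.
rewrite innerDl innerBl !innerBr !innerDr (innerC v u).
by set a := inner u u; set b := inner v v; set c := inner u v; field.
Qed.

Lemma cvg_inner (x y : H ^nat) u v :
  x @ \oo --> u -> y @ \oo --> v ->
  inner (x n) (y n) @[n --> \oo] --> inner u v.
Proof.
move=> xu yv; rewrite polarization !inner_norm !expr2.
under eq_fun do rewrite polarization !inner_norm !expr2.
apply: cvgMl; apply: cvgB; apply: cvgM; apply: cvg_norm;
  by [exact: cvgD|exact: cvgB].
Qed.

End inner_product.

(** * Bounded Borel functions and their integrals *)

Section linear_maps.
Context {R : nzRingType} {V W : lmodType R} {T : V -> W}.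
Hypothesis lT : linear T.

Lemma linear_mapD u v : T (u + v) = T u + T v.
Proof. by rewrite -[u in LHS]scale1r lT scale1r. Qed.

Lemma linear_map0 : T 0 = 0.
Proof. by apply: (addrI (T 0)); rewrite -linear_mapD !addr0. Qed.

Lemma linear_mapZ a u : T (a *: u) = a *: T u.
Proof. by rewrite -[a *: u]addr0 lT linear_map0 addr0. Qed.

Lemma linear_mapB u v : T (u - v) = T u - T v.
Proof. by rewrite linear_mapD -scaleN1r linear_mapZ scaleN1r. Qed.

End linear_maps.

Section bounded_measurable.
Context {R : realType}.
Implicit Types f g : R -> R.

Definition bounded_measurable f :=
  measurable_fun setT f /\ exists C, forall x, `|f x| <= C.

Lemma bounded_measurableD f g : bounded_measurable f ->
  bounded_measurable g -> bounded_measurable (f \+ g).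
Proof.
move=> [mf [C fC]] [mg [D gD]]; split; first exact: measurable_funD.
by exists (C + D) => x; rewrite (le_trans (ler_normD _ _))// lerD.
Qed.

Lemma bounded_measurableM f g : bounded_measurable f ->
  bounded_measurable g -> bounded_measurable (f \* g).
Proof.
move=> [mf [C fC]] [mg [D gD]]; split; first exact: measurable_funM.
by exists (C * D) => x; rewrite normrM ler_pM.
Qed.

Lemma bounded_measurable_cst c : bounded_measurable (cst c).
Proof. by split; [exact: measurable_cst|exists `|c|]. Qed.

Lemma bounded_measurable_indic (B : set (measurableTypeR R)) :
  measurable B -> bounded_measurable \1_B.
Proof.
move=> mB; split; first exact: measurable_indic.
by exists 1 => x; rewrite indicE; case: (_ \in _); rewrite ?normr1 ?normr0.
Qed.

End bounded_measurable.

Section spectral_integrals.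
Context {R : realType} {H : hilbert R} (E : spectral_measure H).
Implicit Types (u v w : H) (f g : R -> R) (S T : H -> H).

Local Notation mu := (scalar_measure E).

Lemma scalar_measureT v : mu v setT = (`|v| ^+ 2)%:E.
Proof. by rewrite /scalar_measure spmT. Qed.

Lemma bounded_measurable_integrable f v :
  bounded_measurable f -> (mu v).-integrable setT (EFin \o f).
Proof.
move=> [mf [C fC]]; apply: measurable_bounded_integrable => //.
  by rewrite [ltLHS](scalar_measureT v) ltry.
exists C; split; first exact: num_real.
by move=> M CM x _; exact: le_trans (fC x) (ltW CM).
Qed.

Lemma norm_Rintegral_le f (C : R) v : measurable_fun setT f ->
  (forall x, `|f x| <= C) -> `|\int[mu v]_x f x| <= C * `|v| ^+ 2.
Proof.
move=> mf fC; have bf : bounded_measurable f by split=> //; exists C.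
apply: le_trans.
  apply: le_normr_Rintegral; first by [].
  exact: bounded_measurable_integrable v bf.
have -> : C * `|v| ^+ 2 = \int[mu v]_x C.
  rewrite Rintegral_cst//; congr (_ * _).
  by rewrite -[X in fine X]/(scalar_measure E v setT) scalar_measureT.
apply: le_Rintegral => //.
- apply: (@bounded_measurable_integrable (fun x => `|f x|) v).
  split; first exact: measurableT_comp.
  by exists C => x; rewrite normr_id.
- exact: bounded_measurable_integrable v (bounded_measurable_cst C).
Qed.

Lemma spectral_dom_bounded f v : bounded_measurable f -> spectral_dom E f v.
Proof.
move=> bf; have /integrableP[_] :=
  bounded_measurable_integrable v (bounded_measurableM bf bf).
rewrite /spectral_dom /=; apply: le_lt_trans; rewrite le_eqVlt; apply/orP; left.
by apply/eqP/eq_integral => x _ /=; rewrite -expr2 ger0_norm// sqr_ge0.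
Qed.

(** The second argument is the operator [∫ f dE] of the step function f. As a
    relation it needs no canonical decomposition of f, and each property
    below is an induction on how f was assembled. *)
Inductive step_integral : (R -> R) -> (H -> H) -> Prop :=
| step_integral_indic c (B : set (measurableTypeR R)) : measurable B ->
    step_integral (fun x => c * \1_B x) (fun v => c *: E B v)
| step_integralD f g S T : step_integral f S -> step_integral g T ->
    step_integral (f \+ g) (S \+ T).

Lemma step_bounded_measurable f T : step_integral f T -> bounded_measurable f.
Proof.
elim=> [c B mB|{}f g S {}T _ bf _ bg]; last exact: bounded_measurableD.
exact: bounded_measurableM (bounded_measurable_cst c)
  (bounded_measurable_indic mB).
Qed.

Lemma step_linear f T : step_integral f T -> linear T.
Proof.
elim=> [c B mB|{}f g S {}T _ lS _ lT] a u v /=.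
  by rewrite spm_linear// scalerDr !scalerA mulrC.
by rewrite lS lT scalerDr addrACA.
Qed.

Lemma step_sym f T : step_integral f T ->
  forall u v, inner (T u) v = inner u (T v).
Proof.
elim=> [c B mB|{}f g S {}T _ sS _ sT] u v /=.
  by rewrite innerZl innerZr spm_sym.
by rewrite innerDl innerDr sS sT.
Qed.

(** The diagonal of the form determines a symmetric operator by
    polarization, so only the measures [mu v] have to be computed with. *)
Lemma step_quad f T : step_integral f T ->
  forall v, inner v (T v) = \int[mu v]_x f x.
Proof.
elim=> [c B mB|{}f g S {}T sf IHf sg IHg] v.
  rewrite RintegralZl//; last first.
    exact: bounded_measurable_integrable (bounded_measurable_indic mB).
  rewrite innerZr /Rintegral integral_indic// setIT.
  by rewrite -[X in fine X]/(scalar_measure E v B) scalar_measureE.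
rewrite innerDr IHf IHg RintegralD//; apply: bounded_measurable_integrable.
  exact: step_bounded_measurable sf.
exact: step_bounded_measurable sg.
Qed.

Lemma step_ext {f f' T T'} : f =1 f' -> T =1 T' ->
  step_integral f T -> step_integral f' T'.
Proof. by move=> /funext -> /funext ->. Qed.

Lemma step_integralZ a f T : step_integral f T ->
  step_integral (fun x => a * f x) (fun v => a *: T v).
Proof.
elim=> [c B mB|{}f g S {}T _ IHf _ IHg].
  apply: (step_ext _ _ (step_integral_indic (a * c) mB)) => x /=.
    by rewrite mulrA.
  by rewrite scalerA.
by apply: (step_ext _ _ (step_integralD IHf IHg)) => x /=;
  rewrite ?mulrDr ?scalerDr.
Qed.

(** Multiplicativity is where [E (B ∩ C) = E B E C] enters. *)
Lemma step_integralM f g S T : step_integral f S -> step_integral g T ->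
  step_integral (f \* g) (S \o T).
Proof.
elim=> [c B mB|f1 f2 S1 S2 sf1 IH1 sf2 IH2] sg; last first.
  apply: (step_ext _ _ (step_integralD (IH1 sg) (IH2 sg))) => x //=.
  by rewrite mulrDl.
elim: sg => [d C mC|g1 g2 T1 T2 _ IH1 _ IH2].
  apply: (step_ext _ _ (step_integral_indic (c * d) (measurableI _ _ mB mC))).
    by move=> x /=; rewrite indicI /=; ring.
  by move=> v /=; rewrite spmI// (linear_mapZ (spm_linear E mB)) scalerA.
apply: (step_ext _ _ (step_integralD IH1 IH2)) => x /=; first by rewrite mulrDr.
by rewrite (linear_mapD (spm_linear E mB)) scalerDr.
Qed.

(** By symmetry and multiplicativity [|T v|^2 = <v, T (T v)>] is the integral of
    [f^2]. *)
Lemma step_norm_le f T (C : R) : step_integral f T -> (forall x, `|f x| <= C) ->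
  forall v, `|T v| <= C * `|v|.
Proof.
move=> sf fC v; have C0 : 0 <= C by exact: le_trans (fC 0).
rewrite -ler_sqr ?nnegrE ?mulr_ge0// exprMn -inner_norm (step_sym sf).
rewrite (step_quad (step_integralM sf sf)).
apply: (le_trans (ler_norm _)); apply: norm_Rintegral_le.
  by have [] := step_bounded_measurable (step_integralM sf sf).
by move=> x /=; rewrite normrM ler_pM.
Qed.

End spectral_integrals.

(** * Functional calculus for bounded Borel functions *)

Section bounded_calculus.
Context {R : realType} {H : hilbert R} (E : spectral_measure H).
Implicit Types (u v w : H) (f g : R -> R) (S T : H -> H).

Local Notation mu := (scalar_measure E).

(** If [|f - g| <= c], adding [c/2] to g where [f >= g] and [-c/2] elsewhere
    halves the error. *)
Lemma step_approx f (C : R) n : measurable_fun setT f ->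
  (forall x, `|f x| <= C) ->
  exists g T, step_integral E g T /\ forall x, `|f x - g x| <= C * 2^-1 ^+ n.
Proof.
move=> mf fC; elim: n => [|n [g [T [sg fg]]]].
  exists (fun x => 0 * \1_set0 x), (fun v => 0 *: E set0 v).
  split; first exact: step_integral_indic.
  by move=> x; rewrite mul0r subr0 expr0 mulr1.
set c := C * 2^-1 ^+ n in fg.
have mg : measurable_fun setT g by have [] := step_bounded_measurable sg.
pose B : set (measurableTypeR R) := (fun x => f x - g x) @^-1` `[0, +oo[.
have mB : measurable B.
  by rewrite -[B]setTI; apply: (measurable_funB mf mg) => //; exact: measurable_itv.
exists ((g \+ (fun x => - (c / 2) * \1_setT x)) \+ (fun x => c * \1_B x)).
exists ((T \+ (fun v => - (c / 2) *: E setT v)) \+ (fun v => c *: E B v)).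
split.
  apply: step_integralD; last exact: step_integral_indic.
  by apply: step_integralD => //; exact: step_integral_indic.
move=> x /=; have -> : C * 2^-1 ^+ n.+1 = c / 2 by rewrite /c exprSr mulrA.
have := fg x; rewrite !indicE in_setT mulr1 !ler_norml.
have -> : (x \in B) = (0 <= f x - g x).
  by apply/idP/idP; rewrite inE /B /= in_itv /= andbT.
by case: (leP 0 (f x - g x)) => ? /andP[? ?]; rewrite ?mulr1 ?mulr0;
  apply/andP; split; lra.
Qed.

(** The geometric rate is explicit so that errors of products of approximations
    can be bounded. *)
Definition bounded_integral f T := exists C fn Tn,
  [/\ forall n : nat, step_integral E (fn n) (Tn n),
      forall (n : nat) x, `|f x - fn n x| <= C * 2^-1 ^+ n &
      forall v, Tn n v @[n --> \oo] --> T v].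

Lemma cvg_half_pow (C : R) : C * 2^-1 ^+ n @[n --> \oo] --> (0 : R).
Proof.
by apply: cvg_geometric; rewrite ger0_norm ?invr_ge0// invf_lt1 ?ltr1n.
Qed.

(** The norm bound for step functions makes the operators of uniform
    approximations of f pointwise Cauchy. *)
Lemma bounded_integral_exists f : bounded_measurable f ->
  exists T, bounded_integral f T.
Proof.
move=> [mf [C fC]].
have /choice[fT fTP] : forall n, exists gT : (R -> R) * (H -> H),
    step_integral E gT.1 gT.2 /\ forall x, `|f x - gT.1 x| <= C * 2^-1 ^+ n.
  by move=> n; have [g [T [sg gT]]] := step_approx n mf fC; exists (g, T).
have cvgT v : cvg ((fT n).2 v @[n --> \oo]).
  apply: cauchy_cvg; apply: cauchy_exP => e e0.
  have /cvgr0Pnorm_lt /(_ _ (divr_gt0 e0 (ltr0n _ 2))) :=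
    cvg_half_pow (C * `|v|).
  case=> N _ PN; exists ((fT N).2 v); exists N => // n /= Nn.
  have [sN fN] := fTP N; have [sn fn] := fTP n.
  have lt_half k : (N <= k)%N -> C * 2^-1 ^+ k * `|v| < e / 2.
    by move=> Nk; rewrite mulrAC (le_lt_trans (ler_norm _))//; exact: PN.
  have sNn := step_integralD sN (step_integralZ (-1) sn).
  have := step_norm_le (C := C * 2^-1 ^+ N + C * 2^-1 ^+ n) sNn _ v.
  rewrite /= scaleN1r mulrDl -ball_normE /= => le_dist.
  apply: le_lt_trans (le_dist _) _.
    move=> x; rewrite mulN1r.
    have -> : (fT N).1 x - (fT n).1 x = (f x - (fT n).1 x) - (f x - (fT N).1 x).
      by ring.
    by rewrite (le_trans (ler_normB _ _))// addrC lerD.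
  by rewrite [ltRHS]splitr ltrD ?lt_half.
exists (fun v => lim ((fT n).2 v @[n --> \oo])).
exists C, (fun n => (fT n).1), (fun n => (fT n).2); split => //.
- by move=> n; have [] := fTP n.
- by move=> n; have [] := fTP n.
Qed.

Lemma step_form f T u v : step_integral E f T ->
  inner u (T v) = spectral_form E f u v.
Proof.
move=> sf; rewrite /spectral_form -!(step_quad sf).
rewrite (linear_mapD (step_linear sf)) (linear_mapB (step_linear sf)).
rewrite innerDl innerBl !innerBr !innerDr -(step_sym sf v u) (innerC _ u).
by field.
Qed.

Lemma spectral_formD f g u v : bounded_measurable f -> bounded_measurable g ->
  spectral_form E (f \+ g) u v = spectral_form E f u v + spectral_form E g u v.
Proof.
move=> bf bg; rewrite /spectral_form !RintegralD//; last first.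
- exact: bounded_measurable_integrable.
- exact: bounded_measurable_integrable.
- exact: bounded_measurable_integrable.
- exact: bounded_measurable_integrable.
by field.
Qed.

Lemma cvg_spectral_form f (fn : nat -> R -> R) (e : R ^nat) u v :
  measurable_fun setT f -> (forall n, bounded_measurable (fn n)) ->
  (forall n x, `|f x - fn n x| <= e n) -> e @ \oo --> 0 ->
  spectral_form E (fn n) u v @[n --> \oo] --> spectral_form E f u v.
Proof.
move=> mf bfn fne e0.
suff cvg_int w : \int[mu w]_x fn n x @[n --> \oo] --> \int[mu w]_x f x.
  by apply: cvgMl; apply: cvgB; exact: cvg_int.
have bf : bounded_measurable f.
  split=> //; have [_ [C fC]] := bfn 0; exists (e 0 + C) => x.
  by rewrite -[f x](subrK (fn 0 x)) (le_trans (ler_normD _ _))// lerD.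
have ew0 : e n * `|w| ^+ 2 @[n --> \oo] --> 0.
  by rewrite -[X in _ --> X](mul0r (`|w| ^+ 2)); exact: cvgMl.
apply/subr_cvg0/norm_cvg0P; apply: squeeze_cvgr ew0; last first.
  exact: cvg_cst.
near=> n; rewrite normr_ge0 distrC/=.
rewrite -RintegralB//; last first.
- exact: bounded_measurable_integrable.
- exact: bounded_measurable_integrable.
apply: norm_Rintegral_le => //.
by apply: measurable_funB => //; have [] := bfn n.
Unshelve. all: by end_near. Qed.

Lemma cvg_seq_unique (V : normedModType R) (x y : V ^nat) (a b : V) :
  x =1 y -> x @ \oo --> a -> y @ \oo --> b -> a = b.
Proof. by move=> /funext -> ya yb; exact: cvg_unique ya yb. Qed.

(** Both sides are limits of their counterparts for step functions. *)
Lemma bounded_integral_form f T u v : measurable_fun setT f ->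
  bounded_integral f T -> inner u (T v) = spectral_form E f u v.
Proof.
move=> mf [C [fn [Tn [sn fnC TnT]]]].
have cform := cvg_spectral_form (u := u) (v := v) mf
  (fun n => step_bounded_measurable (sn n)) fnC (cvg_half_pow C).
apply: (cvg_seq_unique (x := fun n => inner u (Tn n v)) _ _ cform).
  by move=> n /=; exact: step_form.
by apply: cvg_inner => //; exact: cvg_cst.
Qed.

Lemma bounded_integral_sym f T u v : bounded_integral f T ->
  inner (T u) v = inner u (T v).
Proof.
move=> [C [fn [Tn [sn _ TnT]]]].
have cTu : inner (Tn n u) v @[n --> \oo] --> inner (T u) v.
  by apply: cvg_inner => //; exact: cvg_cst.
apply: (cvg_seq_unique (y := fun n => inner u (Tn n v)) _ cTu).
  by move=> n; exact: step_sym.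
by apply: cvg_inner => //; exact: cvg_cst.
Qed.

(** Symmetry moves the first factor to the left, [<u, S T v> = <S u, T v>], and
    the inner product is jointly continuous. *)
Lemma bounded_integral_formM f g S T u v :
  bounded_measurable f -> bounded_measurable g ->
  bounded_integral f S -> bounded_integral g T ->
  inner u (S (T v)) = spectral_form E (f \* g) u v.
Proof.
move=> [mf [F fF]] [mg [G gG]] iS [D [gn [Tn [tn gnD TnT]]]].
have := iS; move=> [C [fn [Sn [sn fnC SnS]]]].
have bfgn n := step_bounded_measurable (step_integralM (sn n) (tn n)).
have cform : spectral_form E (fn n \* gn n) u v @[n --> \oo] -->
    spectral_form E (f \* g) u v.
  (* From fg - f_n g_n = f (g - g_n) + g_n (f - f_n), where |g_n| <= G + D. *)
  apply: (@cvg_spectral_form _ (fun n => fn n \* gn n)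
    (fun n => (F * D + (G + D) * C) * 2^-1 ^+ n)).
  - exact: measurable_funM.
  - exact: bfgn.
  - move=> n x /=.
    have -> : f x * g x - fn n x * gn n x =
        f x * (g x - gn n x) + gn n x * (f x - fn n x) by ring.
    have pow_le1 : (2^-1 : R) ^+ n <= 1 by rewrite exprn_ile1 ?invf_le1 ?ler1n.
    have D0 : 0 <= D.
      by have := gnD 0 0; rewrite expr0 mulr1; exact: le_trans.
    have gnG : `|gn n x| <= G + D.
      have -> : gn n x = g x - (g x - gn n x) by ring.
      rewrite (le_trans (ler_normB _ _))// lerD// (le_trans (gnD n x))//.
      exact: ler_piMr.
    rewrite (le_trans (ler_normD _ _))// mulrDl -!mulrA !normrM.
    by apply: lerD; apply: ler_pM.
  - exact: cvg_half_pow.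
rewrite -(bounded_integral_sym _ _ iS).
apply: (cvg_seq_unique (x := fun n => inner (Sn n u) (Tn n v)) _ _ cform).
  move=> n; rewrite (step_sym (sn n)).
  exact: step_form (step_integralM (sn n) (tn n)).
exact: cvg_inner.
Qed.

Lemma fun_calcE f T v : bounded_measurable f -> bounded_integral f T ->
  fun_calc E f v = T v.
Proof.
move=> bf iT; have [mf _] := bf.
have Tv : spectral_integral E f v (T v).
  by split=> [|u _]; [exact: spectral_dom_bounded|exact: bounded_integral_form].
have [_ form_calc] := xgetPex 0 (ex_intro _ _ Tv).
apply: inner_extr => u; rewrite form_calc; last exact: spectral_dom_bounded.
by rewrite (bounded_integral_form _ _ mf iT).
Qed.

Lemma fun_calc_integral f : bounded_measurable f ->
  bounded_integral f (fun_calc E f).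
Proof.
move=> bf; have [T iT] := bounded_integral_exists bf.
by have -> : fun_calc E f = T by apply/funext => v; exact: fun_calcE.
Qed.

Lemma step_bounded_integral f T : step_integral E f T -> bounded_integral f T.
Proof.
move=> sf; exists 0, (fun=> f), (fun=> T); split=> [//|n x|v].
  by rewrite subrr normr0 mul0r.
exact: cvg_cst.
Qed.

Lemma fun_calc1 v : fun_calc E (cst 1) v = v.
Proof.
have s1 : step_integral E (cst 1) id.
  apply: (step_ext _ _ (step_integral_indic E 1 measurableT)) => [x|w].
    by rewrite indicT mulr1.
  by rewrite spmT scale1r.
exact: fun_calcE (bounded_measurable_cst 1) (step_bounded_integral s1).
Qed.

End bounded_calculus.

(** * The wave propagator *)

Section cosine.
Context {R : realType} {H : hilbert R} (E : spectral_measure H).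
Implicit Types (u v w : H) (s t : R).

Let cosf t : R -> R := fun x => cos (t * Num.sqrt x).

Let bounded_cosf t : bounded_measurable (cosf t).
Proof.
split; last by exists 1 => x; rewrite ler_norml cos_geN1 cos_le1.
apply: continuous_measurable_fun => x.
apply: (@continuous_comp _ _ _ (fun x => t * Num.sqrt x) cos).
  by apply: cvgMr; exact: sqrt_continuous.
exact: continuous_cos.
Qed.

Let integral_cosf t : bounded_integral E (cosf t) (cos_sqrt E t).
Proof. exact: fun_calc_integral. Qed.

Lemma cos_sqrt_sym t u v : inner (cos_sqrt E t u) v = inner u (cos_sqrt E t v).
Proof. exact: bounded_integral_sym (integral_cosf t). Qed.

Lemma cos_sqrt0 v : cos_sqrt E 0 v = v.
Proof.
rewrite -[RHS](fun_calc1 E); congr (fun_calc _ _ _).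
by apply/funext => x; rewrite mul0r cos0.
Qed.

Lemma cos_sqrtN t v : cos_sqrt E (- t) v = cos_sqrt E t v.
Proof.
by congr (fun_calc _ _ _); apply/funext => x; rewrite mulNr cosN.
Qed.

(** This is [2 cos a cos b = cos (a + b) + cos (a - b)], carried over to operators
    by multiplicativity. *)
Lemma cos_sqrt_product s t v :
  2 *: cos_sqrt E s (cos_sqrt E t v) =
  cos_sqrt E (s + t) v + cos_sqrt E (s - t) v.
Proof.
apply: inner_extr => u; rewrite scaler_nat mulr2n !innerDr.
rewrite !(bounded_integral_formM _ _ (bounded_cosf s) (bounded_cosf t)
  (integral_cosf s) (integral_cosf t)).
have mcosf r : measurable_fun setT (cosf r) by have [] := bounded_cosf r.
rewrite !(bounded_integral_form _ _ (mcosf _) (integral_cosf _)).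
rewrite -!spectral_formD//; last first.
- exact: bounded_measurableM.
- exact: bounded_measurableM.
congr (spectral_form E _ u v); apply/funext => x /=.
by rewrite /cosf mulrDl mulrBl cosD cosB; ring.
Qed.

Lemma cos_sqrt_productC s t v :
  2 *: cos_sqrt E s (cos_sqrt E t v) =
  cos_sqrt E (t + s) v + cos_sqrt E (t - s) v.
Proof.
by rewrite cos_sqrt_product -[s - t]opprB cos_sqrtN (addrC s).
Qed.

End cosine.

(** * Chebyshev polynomials of operators and matrices *)

Section polynomial_values.
Context {R : nzRingType} {V : lmodType R}.
Implicit Types (p q : {poly R}) (x : nat -> V).

(** One linear map of p that covers both [poly_op], with [x k] the k-th iterate,
    and [poly_mx], with [x k] the k-th power. *)
Definition coef_sum p x : V := \sum_(k < size p) p`_k *: x k.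

Lemma coef_sum_widen p x N : (size p <= N)%N ->
  coef_sum p x = \sum_(k < N) p`_k *: x k.
Proof.
move=> pN; rewrite /coef_sum (big_ord_widen _ (fun k => p`_k *: x k) pN).
rewrite big_mkcond; apply: eq_bigr => k _; case: ltnP => // pk.
by rewrite nth_default// scale0r.
Qed.

Lemma coef_sumB p q x : coef_sum (p - q) x = coef_sum p x - coef_sum q x.
Proof.
pose N := maxn (size (p - q)) (maxn (size p) (size q)).
rewrite !(@coef_sum_widen _ _ N) ?leq_max ?leqnn ?orbT//.
rewrite -sumrB; apply: eq_bigr => k _.
by rewrite coefB scalerBl.
Qed.

Lemma coef_sumZX a q x :
  coef_sum (a *: 'X * q) x = a *: coef_sum q (fun k => x k.+1).
Proof.
rewrite -scalerAl.
pose N := maxn (size (a *: ('X * q))) (size q).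
rewrite (@coef_sum_widen _ _ N.+1) ?leqW ?leq_maxl//.
rewrite (@coef_sum_widen _ _ N) ?leq_maxr// big_ord_recl.
rewrite coefZ coefXM mulr0 scale0r add0r scaler_sumr.
by apply: eq_bigr => k _; rewrite coefZ coefXM/= scalerA.
Qed.

Lemma coef_sum_chebyshev0 x : coef_sum (chebyshevT R 0) x = x 0.
Proof. by rewrite /coef_sum size_poly1 big_ord1 coef1 scale1r. Qed.

Lemma coef_sum_chebyshev1 x : coef_sum (chebyshevT R 1) x = x 1.
Proof.
rewrite /coef_sum size_polyX big_ord_recl big_ord1 !coefX /=.
by rewrite scale0r scale1r add0r.
Qed.

Lemma coef_sum_chebyshevSS j x : coef_sum (chebyshevT R j.+2) x =
  2 *: coef_sum (chebyshevT R j.+1) (fun k => x k.+1) -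
  coef_sum (chebyshevT R j) x.
Proof. by rewrite coef_sumB coef_sumZX. Qed.

End polynomial_values.

Lemma poly_op_chebyshevSS (R : realType) (H : hilbert R) j (T : H -> H) v :
  poly_op (chebyshevT R j.+2) T v =
  2 *: poly_op (chebyshevT R j.+1) T (T v) - poly_op (chebyshevT R j) T v.
Proof.
rewrite [LHS](coef_sum_chebyshevSS j (fun k => iter k T v)).
by congr (2 *: _ - _); apply: eq_bigr => k _; rewrite -iterSr.
Qed.

Lemma poly_mx_chebyshev0 (R : nzRingType) N (A : 'M[R]_N) :
  poly_mx (chebyshevT R 0) A = 1%:M.
Proof. exact: (coef_sum_chebyshev0 (fun k => A ^+ k)). Qed.

Lemma poly_mx_chebyshev1 (R : nzRingType) N (A : 'M[R]_N) :
  poly_mx (chebyshevT R 1) A = A.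
Proof. exact: (coef_sum_chebyshev1 (fun k => A ^+ k)). Qed.

Lemma poly_mx_chebyshevSS (R : comNzRingType) N j (A : 'M[R]_N) :
  poly_mx (chebyshevT R j.+2) A =
  2 *: (A *m poly_mx (chebyshevT R j.+1) A) - poly_mx (chebyshevT R j) A.
Proof.
rewrite [LHS](coef_sum_chebyshevSS j (fun k => A ^+ k)); congr (2 *: _ - _).
rewrite /coef_sum mulmx_sumr; apply: eq_bigr => k _.
by rewrite -scalemxAr exprS.
Qed.

(** The recurrence applies the last factor P to v first, so the induction is
    over all v at once. *)
Lemma poly_op_cos_sqrt (R : realType) (H : hilbert R) (E : spectral_measure H)
    (t : R) j v :
  poly_op (chebyshevT R j) (cos_sqrt E t) v = cos_sqrt E (j%:R * t) v.
Proof.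
elim/ltn_ind: j v => -[|[|j]] IH v.
- by rewrite [LHS](coef_sum_chebyshev0 (fun k => iter k _ v)) mul0r cos_sqrt0.
- by rewrite [LHS](coef_sum_chebyshev1 (fun k => iter k _ v)) mul1r.
rewrite poly_op_chebyshevSS !IH// cos_sqrt_product.
rewrite -[X in _ + X - _](_ : cos_sqrt E (j%:R * t) v = _) ?addrK.
  by congr (cos_sqrt _ _ _); rewrite -!natr1; ring.
by congr (cos_sqrt _ _ _); rewrite -!natr1; ring.
Qed.

(** The identity [2 T_a T_b = T_(a+b) + T_(a-b)], with a = b + d, for any
    [G a b] that behaves as [<T_a(P) x, T_b(P) x>] with P symmetric: the
    hypotheses say that multiplication by 2P may be moved from one side to the
    other. *)
Lemma chebyshev_product (V : zmodType) (G : nat -> nat -> V) :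
  (forall a, G a.+2 0 + G a 0 = G a.+1 1 *+ 2) ->
  (forall a b, G a.+2 b.+1 + G a b.+1 = G a.+1 b.+2 + G a.+1 b) ->
  forall b d, G (b + d)%N b *+ 2 = G (b.*2 + d)%N 0 + G d 0.
Proof.
move=> G0 GS b d; elim/ltn_ind: b d => -[|[|b]] IH d.
- by rewrite mulr2n.
- by rewrite -G0.
have -> : G (b.+2 + d)%N b.+2 =
    G (b.+1 + d.+2)%N b.+1 + G (b.+1 + d)%N b.+1 - G (b + d.+2)%N b.
  by rewrite !addnS !addSn GS addrK.
rewrite mulrnBl mulrnDl !IH//.
have -> : (b.+2.*2 + d = b.+1.*2 + d.+2)%N by rewrite !doubleS !addnS !addSn.
have -> : (b.+1.*2 + d = b.*2 + d.+2)%N by rewrite !doubleS !addnS !addSn.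
by rewrite [X in _ + X - _]addrC addrACA [X in _ - X]addrC addrK.
Qed.

(** * Mass and stiffness matrices *)

Section gram_matrices.
Context {R : realType} {H : hilbert R} {m n : nat}.
Implicit Types (v w : 'I_m -> H) (u : nat -> 'I_m -> H) (P : H -> H).

Lemma tr_gram v w : (gram v w)^T = gram w v.
Proof. by apply/matrixP => r s; rewrite !mxE innerC. Qed.

Lemma mul_mxblock_block_e (B_ : 'I_n -> 'I_n -> 'M[R]_m) (k : 'I_n) :
  \mxblock_(i < n, j < n) B_ i j *m block_e k = \mxcol_(i < n) B_ i k.
Proof.
rewrite mul_mxblock_mxrow; apply: eq_mxcol => i.
rewrite (bigD1 k)//= eqxx mulmx1 big1 ?addr0// => j jk.
by rewrite ifN ?mulmx0.
Qed.

Definition gram_col u (w : 'I_m -> H) : 'M[R]_(block_dim n m, m) :=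
  \mxcol_(i < n) gram (u i) w.

Lemma mass_mx_block_e u k : (k < n)%N ->
  mass_mx n u *m block_e k = gram_col u (u k).
Proof. by move=> kn; exact: (mul_mxblock_block_e _ (Ordinal kn)). Qed.

Lemma stiffness_mx_block_e P u k : (k < n)%N ->
  stiffness_mx n P u *m block_e k = gram_col u (P \o u k).
Proof. by move=> kn; exact: (mul_mxblock_block_e _ (Ordinal kn)). Qed.

Lemma gram_col_tr_block_e u w k : (k < n)%N ->
  (gram_col u w)^T *m block_e k = gram w (u k).
Proof.
move=> kn; rewrite tr_mxcol mul_mxrow_mxcol.
rewrite (bigD1 (Ordinal kn))//= eqxx mulmx1 tr_gram big1 ?addr0// => j jk.
by rewrite ifN ?mulmx0.
Qed.

Lemma tr_mass_mx u : (mass_mx n u)^T = mass_mx n u.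
Proof.
by rewrite tr_mxblock; apply: eq_mxblock => i j; rewrite tr_gram.
Qed.

Lemma tr_stiffness_mx P u : (forall x y : H, inner (P x) y = inner x (P y)) ->
  (stiffness_mx n P u)^T = stiffness_mx n P u.
Proof.
move=> symP; rewrite tr_mxblock; apply: eq_mxblock => i j; rewrite tr_gram.
by apply/matrixP => r s; rewrite !mxE/= symP.
Qed.

(** If the row c is in the kernel of M, the combination w of the snapshots with
    coefficients c is orthogonal to every snapshot, hence to itself. *)
Lemma mass_mx_unit u : lin_indep_upto u n -> mass_mx n u \in unitmx.
Proof.
move=> indep; rewrite -row_free_unit; apply: inj_row_free => c.
rewrite -[c]submxrowK mul_mxrow_mxblock; set C := submxrow c => cM0.
pose w := \sum_(i < n) \sum_r C i 0 r *: u i r.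
have w_orth (j : 'I_n) s : inner w (u j s) = 0.
  have /mxrowP/(_ j)/matrixP/(_ 0 s) := cM0.
  rewrite mxrowK submxrow0 mxE summxE => <-.
  rewrite inner_suml; apply: eq_bigr => i _.
  rewrite inner_suml mxE; apply: eq_bigr => r _.
  by rewrite innerZl; congr (_ * _); rewrite mxE.
have w0 : w = 0.
  apply/eqP; rewrite -normr_eq0 -sqrf_eq0 -inner_norm {2}/w.
  rewrite inner_sumr big1// => i _; rewrite inner_sumr big1// => r _.
  by rewrite innerZr w_orth mulr0.
(* The last snapshot u_n gets the coefficient 0. *)
pose d (i : 'I_n.+1) r := if unlift ord_max i is Some i' then C i' 0 r else 0.
have /indep d0 : \sum_i \sum_r d i r *: u i r = 0.
  rewrite big_ord_recr /= [X in _ + X]big1 ?addr0; last first.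
    by move=> r _; rewrite /d unlift_none scale0r.
  rewrite -[RHS]w0; apply: eq_bigr => i _; apply: eq_bigr => r _.
  have -> : widen_ord (leqnSn n) i = lift ord_max i.
    by apply/val_inj; rewrite /= /bump leqNgt ltn_ord.
  by rewrite /d liftK.
rewrite -[RHS](mxrow0 1); apply: eq_mxrow => i.
apply/rowP => r; have := d0 (lift ord_max i) r.
by rewrite /d liftK => ->; rewrite mxE.
Qed.

End gram_matrices.

(** * Reduced order model *)

Section reduced_order_model.
Context {R : realType} {N m : nat} (M S Rc : 'M[R]_N).
Hypothesis cholesky : M = Rc^T *m Rc.
Hypothesis unitM : M \in unitmx.

Let unitRc : Rc \in unitmx.
Proof. by move: unitM; rewrite cholesky unitmx_mul => /andP[]. Qed.

Let PROM := (invmx Rc)^T *m S *m invmx Rc.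

Lemma rom_step (x y z : 'M[R]_(N, m)) :
  M *m x = 2 *: (S *m y) - M *m z ->
  Rc *m x = 2 *: (PROM *m (Rc *m y)) - Rc *m z.
Proof.
move=> /(congr1 (mulmx (invmx Rc)^T)).
rewrite mulmxBr -scalemxAr cholesky -!(mulmxA Rc^T) !mulmxA.
rewrite -trmx_mul mulmxV// trmx1 !mul1mx => ->.
by rewrite /PROM mulmxKV.
Qed.

Lemma tr_PROM : S^T = S -> PROM^T = PROM.
Proof. by move=> trS; rewrite !trmx_mul trmxK trS mulmxA. Qed.

End reduced_order_model.

Lemma rom_chebyshev (R : realType) (N m : nat) (A : 'M[R]_N)
    (x : nat -> 'M[R]_(N, m)) :
  x 1 = A *m x 0 ->
  (forall j, x j.+2 = 2 *: (A *m x j.+1) - x j) ->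
  forall j, x j = poly_mx (chebyshevT R j) A *m x 0.
Proof.
move=> x1 xSS; elim/ltn_ind => -[|[|j]] IH.
- by rewrite poly_mx_chebyshev0 mul1mx.
- by rewrite poly_mx_chebyshev1.
rewrite poly_mx_chebyshevSS mulmxBl -scalemxAl -mulmxA -!IH//.
Qed.

Section galerkin.
Context {R : realType} {H : hilbert R} {m n : nat} {P : H -> H}.
Context {u : nat -> 'I_m -> H} {g : int -> 'M[R]_(block_dim n m, m)}.

Local Notation M := (mass_mx n u).
Local Notation S := (stiffness_mx n P u).

Hypothesis n_gt1 : (1 < n)%N.
Hypothesis unitM : M \in unitmx.
Hypothesis gramSS : forall w k,
  gram w (u k.+2) + gram w (u k) = gram w (P \o u k.+1) *+ 2.
Hypothesis galerkin : galerkin_coefs M S g.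

Lemma galerkin0 : g 0 = block_e 0.
Proof. by case: galerkin. Qed.

(** The relation at j = 0, where [g_(-1) = g_1]. *)
Lemma galerkin1 : M *m g 1 = 2 *: (S *m g 0) - M *m g 1.
Proof.
have [_ g1 gN1 gSS] := galerkin.
by move/(_ 0 (lexx 0)): gSS; rewrite add0r sub0r gN1 -g1.
Qed.

Lemma galerkinSS (j : nat) :
  M *m g j.+2%:Z = 2 *: (S *m g j.+1%:Z) - M *m g j%:Z.
Proof.
have [_ _ _ /(_ j.+1%:Z isT)] := galerkin.
have -> : j.+1%:Z + 1 = j.+2%:Z by rewrite [RHS]intS addrC.
by have -> : j.+1%:Z - 1 = j%:Z by rewrite intS addrC addKr.
Qed.

(** For j < n the equation says that [g_j] is a block unit vector, and then [S g_j]
    consists of inner products with [P u_j], so that the recurrence passes to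
    j + 1. Hence j = n is the last case reached in this way. *)
Lemma galerkin_snapshots (j : nat) : (j <= n)%N ->
  M *m g j%:Z = gram_col u (u j).
Proof.
elim/ltn_ind: j => -[|[|j]] IH jn; have [g0 g1 _ _] := galerkin.
- by rewrite g0 mass_mx_block_e// ltnW.
- by rewrite g1 mass_mx_block_e.
have gj : g j.+1%:Z = block_e j.+1.
  by apply: (can_inj (mulKmx unitM)); rewrite IH// ?mass_mx_block_e// ltnW.
rewrite galerkinSS gj stiffness_mx_block_e// IH//; last by rewrite ltnW// ltnW.
apply/eqP; rewrite subr_eq scaler_nat mulr2n -!mxcolD; apply/eqP.
by apply: eq_mxcol => i; rewrite gramSS mulr2n.
Qed.

Lemma galerkin_mass_mx (a b : nat) : (a <= n)%N -> (b < n)%N ->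
  (g a%:Z)^T *m M *m g b%:Z = gram (u a) (u b).
Proof.
move=> an bn; rewrite -[M in LHS]tr_mass_mx -trmx_mul galerkin_snapshots//.
have -> : g b%:Z = block_e b.
  apply: (can_inj (mulKmx unitM)).
  by rewrite galerkin_snapshots ?mass_mx_block_e// ltnW.
exact: gram_col_tr_block_e.
Qed.

End galerkin.

Lemma chebyshev_gram_mx (R : realType) (N m : nat) (A : 'M[R]_N)
    (x : nat -> 'M[R]_(N, m)) b d :
  A^T = A -> x 1 = A *m x 0 ->
  (forall j, x j.+2 = 2 *: (A *m x j.+1) - x j) ->
  ((x (b + d)%N)^T *m x b) *+ 2 = (x (b.*2 + d)%N)^T *m x 0 + (x d)^T *m x 0.
Proof.
move=> trA x1 xSS.
have xDx j : x j.+2 + x j = (A *m x j.+1) *+ 2 by rewrite xSS subrK scaler_nat.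
have stepl a y : (x a.+2)^T *m y + (x a)^T *m y = ((x a.+1)^T *m (A *m y)) *+ 2.
  by rewrite -mulmxDl -linearD/= xDx linearMn/= -scaler_nat -scalemxAl
    scaler_nat trmx_mul trA mulmxA.
apply: (chebyshev_product (G := fun a b => (x a)^T *m x b)) => [a|a c].
  by rewrite stepl x1.
by rewrite stepl -[RHS]mulmxDr xDx !mulr2n mulmxDr.
Qed.

Lemma chebyshev_gram (R : realType) (H : hilbert R) (m : nat) (P : H -> H)
    (u : nat -> 'I_m -> H) b d :
  (forall x y : H, inner (P x) y = inner x (P y)) ->
  P \o u 0 =1 u 1 ->
  (forall k r, u k.+2 r + u k r = 2 *: P (u k.+1 r)) ->
  gram (u (b + d)%N) (u b) *+ 2 =
    gram (u (b.*2 + d)%N) (u 0) + gram (u d) (u 0).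
Proof.
move=> symP u1 uSS.
apply: (chebyshev_product (G := fun a b => gram (u a) (u b))) => [a|a c];
  apply/matrixP => r s; rewrite ?mulmxnE !mxE -innerDl uSS scaler_nat mulr2n.
  by rewrite innerDl symP -!u1.
by rewrite -innerDr uSS scaler_nat mulr2n innerDl innerDr symP.
Qed.

Theorem theorem2p3 (R : realType) (H K : hilbert R)
    (L : unbounded_op K H) (LT : unbounded_op H K) (E : spectral_measure H)
    (tau : R) (m n : nat) (b : 'I_m -> H)
    (Rc : 'M[R]_(block_dim n m)) (g : int -> 'M[R]_(block_dim n m, m)) :
  linear_op L -> is_adjoint L LT ->
  self_adjoint (op_comp L LT) -> nonneg_op (op_comp L LT) ->
  spectral_measure_of E (op_comp L LT) ->
  0 < tau -> (1 <= m)%N -> (2 <= n)%N ->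
  let P : H -> H := cos_sqrt E tau in
  let u (j : nat) : 'I_m -> H := cos_sqrt E (j%:R * tau) \o b in
  let D (j : nat) : 'M[R]_m := gram b (u j) in
  let M := mass_mx n u in
  let S := stiffness_mx n P u in
  lin_indep_upto u n ->
  block_cholesky M Rc ->
  galerkin_coefs M S g ->
  let PROM := (invmx Rc)^T *m S *m invmx Rc in
  let bROM := Rc *m block_e 0 in
  let uROM (j : nat) := Rc *m g j%:Z in
  (forall j : nat, uROM j = poly_mx (chebyshevT R j) PROM *m bROM) /\
  (forall j : nat, (j <= 2 * n - 1)%N ->
     D j = gram b (poly_op (chebyshevT R j) P \o b) /\
     gram b (poly_op (chebyshevT R j) P \o b) =
       bROM^T *m poly_mx (chebyshevT R j) PROM *m bROM).
Proof.
move=> _ _ _ _ _ _ _ n_gt1 P u D M S indep [_ cholesky] galerkin PROM bROM uROM.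
have unitM : M \in unitmx by exact: mass_mx_unit.
have Pu k r : u k.+2 r + u k r = 2 *: P (u k.+1 r).
  rewrite /P /u/= cos_sqrt_productC.
  by congr (cos_sqrt _ _ _ + cos_sqrt _ _ _); rewrite -!natr1; ring.
have u0 : u 0 = b by apply/funext => r; rewrite /u/= mul0r cos_sqrt0.
have Pu0 r : P (u 0 r) = u 1 r by rewrite u0 /u/= mul1r.
have symP x y : inner (P x) y = inner x (P y) by exact: cos_sqrt_sym.
have gramSS w k :
    gram w (u k.+2) + gram w (u k) = gram w (P \o u k.+1) *+ 2.
  by apply/matrixP => r s; rewrite mulmxnE !mxE -innerDr Pu scaler_nat mulr2n
    innerDr.
have romSS j : uROM j.+2 = 2 *: (PROM *m uROM j.+1) - uROM j.
  exact: (rom_step cholesky unitM (galerkinSS galerkin j)).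
have uROM0 : uROM 0 = bROM by rewrite /uROM (galerkin0 galerkin).
(* The relation at j = 0 gives uROM_1 = 2 PROM uROM_0 - uROM_1. *)
have rom1 : uROM 1 = PROM *m uROM 0.
  have := rom_step cholesky unitM (galerkin1 galerkin).
  rewrite -/(uROM 1) -/(uROM 0) => /eqP.
  rewrite -subr_eq0 opprB addrA -mulr2n -scaler_nat -scalerBr.
  by rewrite scaler_eq0 pnatr_eq0/= subr_eq0 => /eqP.
have romE j : uROM j = poly_mx (chebyshevT R j) PROM *m bROM.
  by rewrite -uROM0; exact: rom_chebyshev.
have trPROM : PROM^T = PROM by apply: tr_PROM; exact: tr_stiffness_mx.
have fit_gram k l : (k <= n)%N -> (l < n)%N ->
    (uROM k)^T *m uROM l = gram (u k) (u l).
  move=> kn ln; rewrite -(galerkin_mass_mx n_gt1 unitM gramSS galerkin kn ln).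
  by rewrite -[mass_mx n u]/M cholesky trmx_mul !mulmxA.
split=> [//|j j_le].
have polyE : poly_op (chebyshevT R j) P \o b = u j.
  by apply/funext => r; rewrite /u/= poly_op_cos_sqrt.
(* Transposing puts the initial wave on the right, as in [chebyshev_product]. *)
rewrite polyE; split=> //; apply: trmx_inj.
rewrite -mulmxA -romE trmx_mul trmxK tr_gram -{1}u0 -uROM0.
have gram_cheb := chebyshev_gram (j./2) (odd j) symP Pu0 Pu.
have := chebyshev_gram_mx (j./2) (odd j) trPROM rom1 romSS.
rewrite (fit_gram (j./2 + odd j)%N) 1?(fit_gram (odd j)); [|lia..].
rewrite gram_cheb => /addIr.
by have -> : (j./2.*2 + odd j)%N = j by rewrite addnC odd_double_half.
Qed.
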